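(* Let $G$ be a group and let $X$ be a generating set of $G$. Suppose that the Cayley graph $\Gamma(G,X)$ is hyperbolic and acylindrical. Then there exists a constant $N_0>0$ such that for any loxodromic (with respect to $X$) elements $c,d\in G$ with $E_G(c)\neq E_G(d)$ and for any $n,m\in\mathbb{N}$ we have $$|c^nd^m|_X>\frac{\min\{n,m\}}{N_0}.$$
   Context: Generating sets are symmetric and may be infinite. $\mathbb{N}$ denotes the positive integers. $|g|_X$ is the length of a shortest word in $X$ representing $g$. $\Gamma(G,X)$ is acylindrical if the left action of $G$ on it is acylindrical, i.e. for every $\varepsilon>0$ there exist $R,N>0$ such that for any points $x,y$ with $d(x,y)\geqslant R$ there are at most $N$ elements $g\in G$ with $d(x,gx)\leqslant\varepsilon$ and $d(y,gy)\leqslant\varepsilon$. An element $g\in G$ is loxodromic with respect to $X$ if $n\mapsto g^nx$ is a quasi-isometric embedding $\mathbb{Z}\to\Gamma(G,X)$ for some (equivalently, any) $x$. For loxodromic $g$, $E_G(g)=\{f\in G\mid \exists\, n\in\mathbb{N}: f^{-1}g^nf=g^{\pm n}\}$ (the unique maximal virtually cyclic subgroup containing $g$). *)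

(* Defs.v *)
From mathcomp Require Import all_boot all_order all_algebra.
From mathcomp Require Import all_classical all_reals.

Set Implicit Arguments.
Unset Strict Implicit.
Unset Printing Implicit Defensive.

Import Order.TTheory GRing.Theory Num.Theory.

Local Open Scope classical_set_scope.
Local Open Scope ring_scope.

(* The distance functions [d] below may be pseudometrics: the points of the
   Cayley graph are represented up to distance zero (see [cayley_point]). *)

Definition geodesic_segment (R : realType) (T : Type) (d : T -> T -> R)
    (x y : T) (S : set T) : Prop :=
  exists gamma : R -> T,
    [/\ d (gamma 0) x = 0,
        d (gamma (d x y)) y = 0,
        forall s t : R, 0 <= s <= d x y -> 0 <= t <= d x y ->
          d (gamma s) (gamma t) = `|s - t|
      & S = gamma @` [set s | 0 <= s <= d x y]].

(* Rips' condition: geodesic triangles are uniformly slim.  Only the side [A]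
   is constrained; permuting the vertices gives the other two.  The ambient
   space is meant to be geodesic, as every Cayley graph is. *)
Definition hyperbolic (R : realType) (T : Type) (d : T -> T -> R) : Prop :=
  exists2 delta : R, 0 <= delta &
    forall (x y z : T) (A B C : set T),
      geodesic_segment d x y A ->
      geodesic_segment d y z B ->
      geodesic_segment d z x C ->
      forall p, A p -> exists2 q, (B `|` C) q & d p q <= delta.

Definition acylindrical (R : realType) (G : groupType) (T : Type)
    (d : T -> T -> R) (act : G -> T -> T) : Prop :=
  forall eps : R, 0 < eps ->
    exists (r : R) (N : nat), [/\ 0 < r, (0 < N)%N &
      forall x y : T, r <= d x y ->
        ([set g | d x (act g x) <= eps /\ d y (act g y) <= eps] #<= `I_N)%card].

Definition qi_embedding (R : realType) (S T : Type)
    (dS : S -> S -> R) (dT : T -> T -> R) (f : S -> T) : Prop :=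
  exists lambda kappa : R, [/\ 1 <= lambda, 0 <= kappa &
    forall a b : S,
      dS a b / lambda - kappa <= dT (f a) (f b) <= lambda * dS a b + kappa].

Definition int_dist (R : realType) (a b : int) : R := `|a - b|%:~R.

Section Groups.
Local Open Scope group_scope.

Definition expgz (G : groupType) (g : G) (k : int) : G :=
  match k with
  | Posz n => g ^+ n
  | Negz n => g ^- n.+1
  end.

Definition inv_closed (G : groupType) (X : set G) : Prop :=
  forall x, X x -> X x^-1.

Definition represents (G : groupType) (X : set G) (w : seq G) (g : G) : Prop :=
  (forall x, x \in w -> X x) /\ \prod_(x <- w) x = g.

(* Words in [X] suffice, without inverses, since this is only used for
   inverse-closed [X]. *)
Definition generates (G : groupType) (X : set G) : Prop :=
  forall g, exists w, represents X w g.

(* The default value 0 is irrelevant when [X] generates [G]. *)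
Definition word_length (G : groupType) (X : set G) (g : G) : nat :=
  xget 0%N [set n |
    (exists2 w, represents X w g & size w = n) /\
    (forall w, represents X w g -> (n <= size w)%N)].

Definition E_ (G : groupType) (g : G) : set G :=
  [set f | exists2 n : nat, (0 < n)%N &
    f^-1 * g ^+ n * f = g ^+ n \/ f^-1 * g ^+ n * f = g ^- n].

End Groups.

(* Geometric realization of the Cayley graph: the point of the edge from [src]
   to [tgt] at fraction [pos] of the way.  A vertex [u] is also represented by
   the degenerate edge from [u] to [u], whatever [pos] is (so loops, which occur
   if [X] contains 1, are collapsed).  The same point may be represented several
   times; when [X] generates [G], [cayley_dist] vanishes exactly on pairs
   representing the same point. *)
Record cayley_point (R : realType) (G : groupType) (X : set G) := CayleyPoint {
  src : G;
  tgt : G;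
  pos : R;
  _ : src = tgt \/ X (src^-1 * tgt)%g;
  _ : 0 <= pos <= 1 }.

Section CayleyGraph.
Variables (R : realType) (G : groupType) (X : set G).
Implicit Types (p q : cayley_point R X) (g u v : G).

Definition edge_length p : R := (src p != tgt p)%:R.
Definition to_src p : R := pos p * edge_length p.
Definition to_tgt p : R := (1 - pos p) * edge_length p.

Definition vertex_dist u v : R := (word_length X (u^-1 * v)%g)%:R.

(* Length of a shortest path from [p] to [q] through vertices. *)
Definition dist_via p q : R :=
  Num.min
    (Num.min (to_src p + vertex_dist (src p) (src q) + to_src q)
             (to_src p + vertex_dist (src p) (tgt q) + to_tgt q))
    (Num.min (to_tgt p + vertex_dist (tgt p) (src q) + to_src q)
             (to_tgt p + vertex_dist (tgt p) (tgt q) + to_tgt q)).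

(* Edges are unoriented: the edge from [u] to [v] labelled [x] and the edge from
   [v] to [u] labelled [x^-1] are the same. *)
Definition cayley_dist p q : R :=
  if (src p == src q) && (tgt p == tgt q) then `|to_src p - to_src q|
  else if (src p == tgt q) && (tgt p == src q) then `|to_src p - to_tgt q|
  else dist_via p q.

Fact cayley_act_subproof g p :
  (g * src p = g * tgt p \/ X ((g * src p)^-1 * (g * tgt p)))%g.
Proof.
case: p => u v t /= [->|uvX] _; first by left.
by right; rewrite invgM -mulgA mulKg.
Qed.

Fact cayley_pos_subproof p : 0 <= pos p <= 1.
Proof. by case: p. Qed.

Definition cayley_act g p : cayley_point R X :=
  CayleyPoint (cayley_act_subproof g p) (cayley_pos_subproof p).

Definition loxodromic g : Prop :=
  exists p, qi_embedding (int_dist R) cayley_dist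
              (fun k : int => cayley_act (expgz g k) p).

End CayleyGraph.

Arguments cayley_dist R {G} X p q.
Arguments cayley_act R {G} X g p.
Arguments loxodromic R {G} X g.

(* Main.v *)
(* Suppose that c^-n and d^m are much closer to each other than n and m are
   large.  A geodesic from 1 to c^-n runs to the axis of c, follows it, and
   comes back along a translate of its first part, and likewise for d; the two
   geodesics fellow-travel and the axes occupy their middle parts.

   Acylindricity bounds translation lengths of loxodromic elements uniformly
   from below, so the axes overlap along a segment that is long compared with
   the hyperbolicity and acylindricity constants.  If the overlap contains many
   periods of both c and d, the commutators of powers of c with a fixed power of
   d move two distant points a bounded amount, two of them coincide, and a power
   of c commutes with a power of d.  Otherwise the axis of d is short compared
   with the translation length of c, and d^m maps the part of the geodesic
   before the axis of d, which contains a long part of the axis of c, onto the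
   part after it with the orientation reversed; acylindricity then shows that
   d^m inverts a power of c, which is impossible for a loxodromic d^m.  Powers of
   commuting loxodromic elements are commensurable, hence E(c) = E(d).

   All estimates are made on the group itself, with the integer-valued word
   metric and Gromov's four-point condition. *)

Require Import Defs.
From mathcomp Require Import all_boot all_order all_algebra.
From mathcomp Require Import all_classical all_reals.
From mathcomp Require Import zify lra.

Set Implicit Arguments.
Unset Strict Implicit.
Unset Printing Implicit Defensive.

Import Order.TTheory GRing.Theory Num.Theory.

(** * Isometries of a hyperbolic length function *)

Section HyperbolicLength.
Local Open Scope group_scope.
Local Open Scope nat_scope.

Variables (G : groupType) (ln : G -> nat) (D : nat).
Implicit Types (g h f x y z p : G).

Definition ldist x y : nat := ln (x^-1 * y)%g.

Hypothesis ln1 : ln 1%g = 0.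
Hypothesis lnV : forall x, ln x^-1%g = ln x.
Hypothesis lnM : forall x y, ln (x * y)%g <= ln x + ln y.
Hypothesis ldist_geodesic : forall x y t, t <= ldist x y ->
  exists2 p, ldist x p = t & ldist p y = ldist x y - t.
Hypothesis four_point : forall x y z w,
  ldist x z + ldist y w <= maxn (ldist x y + ldist z w) (ldist y z + ldist x w) + D.
(** Acylindricity as a pigeonhole principle: [N + 1] elements moving two distant points by at most
    [e] contain a repetition. *)
Hypothesis ldist_acylindrical : forall e, exists r N, forall x y, r <= ldist x y ->
  forall F : nat -> G,
    (forall i, i <= N -> ldist x (F i * x)%g <= e /\ ldist y (F i * y)%g <= e) ->
    exists i j, [/\ i < j, j <= N & F i = F j].

Local Notation lnX g i := (ln (g ^+ i)%g).

(** The lower half of the quasi-isometry inequality for the powers of [g], with a single constant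
    for slope and offset; [ln_exp_le] is the upper half. *)
Definition linear_orbit g := exists A, forall k, k <= A * (ln (g ^+ k)%g).+1.

Lemma ldistC x y : ldist x y = ldist y x.
Proof. by rewrite /ldist -lnV invgM invgK. Qed.

Lemma ldist1 x : ldist 1%g x = ln x.
Proof. by rewrite /ldist invg1 mul1g. Qed.

Lemma ldistx1 x : ldist x 1%g = ln x.
Proof. by rewrite ldistC ldist1. Qed.

Lemma ldistMl z x y : ldist (z * x)%g (z * y)%g = ldist x y.
Proof. by rewrite /ldist invgM -mulgA mulKg. Qed.

Lemma ldist_triangle y x z : ldist x z <= ldist x y + ldist y z.
Proof.
rewrite /ldist; have -> : (x^-1 * z = (x^-1 * y) * (y^-1 * z))%g by rewrite -mulgA mulVKg.
exact: lnM.
Qed.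

Lemma ldist_exp g i j : ldist (g ^+ i)%g (g ^+ (i + j))%g = ln (g ^+ j)%g.
Proof. by rewrite /ldist expgnDr mulKg. Qed.

Lemma ln_exp_triangle g i j : ln (g ^+ (i + j))%g <= ln (g ^+ i)%g + ln (g ^+ j)%g.
Proof. by rewrite expgnDr lnM. Qed.

Lemma ln_exp_le g i : ln (g ^+ i)%g <= i * ln g.
Proof.
elim: i => [|i IH]; first by rewrite expg0 ln1.
by rewrite expgS mulSn; apply: leq_trans (lnM _ _) _; rewrite leq_add2l.
Qed.

(** The four-point condition locates a point near a geodesic from its distances to the two ends. *)
Lemma ldist_near x y p q e : ldist x p + ldist p y = ldist x y ->
  ldist x q <= ldist x p + e -> ldist q y <= ldist p y + e -> ldist p q <= e + D.
Proof.
move=> pxy xq qy; have := four_point x p y q.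
rewrite (ldistC y q); lia.
Qed.

(** * Growth of the powers of a loxodromic element *)

Lemma linear_orbit_inj g : linear_orbit g -> injective (fun i => (g ^+ i)%g).
Proof.
move=> [A gA]; have torsionfree k : (g ^+ k)%g = 1%g -> k = 0.
  by move=> gk; have := gA (k * A.+1); rewrite expgnA gk expg1n ln1; nia.
move=> i j; wlog ij : i j / i <= j => [hw e|/esym].
  by case: (leqP i j) => [|/ltnW] h; [exact: hw|apply/esym/hw].
rewrite -{1}(subnKC ij) expgnDr => /(canRL (mulKg _)); rewrite mulVg.
by move=> /torsionfree; lia.
Qed.

Lemma last_visit g T : linear_orbit g ->
  exists2 s, ln (g ^+ s)%g <= T & forall i, s < i -> T < ln (g ^+ i)%g.
Proof.
move=> [A gA].
have ex0 : exists i, ln (g ^+ i)%g <= T by exists 0; rewrite expg0 ln1.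
have ub i : ln (g ^+ i)%g <= T -> i <= A * T.+1.
  by move=> h; apply: leq_trans (gA i) _; rewrite leq_mul2l ltnS h orbT.
case: (ex_maxnP ex0 ub) => s sT smax; exists s => // i; rewrite ltnNge => /negP si.
by rewrite ltnNge; apply/negP => /smax.
Qed.

(** The four points are 1, [g ^+ i], [g ^+ (s + i)] and [g ^+ (s + i + j)]. When the pairing of [i]
    with [j] is small, the other two agree up to [D]: the shift [lnX g (s + x) - lnX g s] is almost
    additive in [x]. *)
Lemma expg_four_point g s i j :
  (lnX g (s + i + j) + lnX g s <= maxn (lnX g (s + i) + lnX g (s + j)) (lnX g i + lnX g j) + D) /\
  (lnX g (s + i) + lnX g (s + j) <= maxn (lnX g (s + i + j) + lnX g s) (lnX g i + lnX g j) + D).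
Proof.
have d0i : ldist 1%g (g ^+ i)%g = lnX g i by rewrite ldist1.
have d0s : ldist 1%g (g ^+ (s + i))%g = lnX g (s + i) by rewrite ldist1.
have d0e : ldist 1%g (g ^+ (s + i + j))%g = lnX g (s + i + j) by rewrite ldist1.
have dis : ldist (g ^+ i)%g (g ^+ (s + i))%g = lnX g s by rewrite addnC ldist_exp.
have die : ldist (g ^+ i)%g (g ^+ (s + i + j))%g = lnX g (s + j).
  by rewrite (addnC s) -addnA ldist_exp.
have dse : ldist (g ^+ (s + i))%g (g ^+ (s + i + j))%g = lnX g j by rewrite ldist_exp.
have := four_point 1%g (g ^+ i)%g (g ^+ (s + i + j))%g (g ^+ (s + i))%g.
have := four_point 1%g (g ^+ i)%g (g ^+ (s + i))%g (g ^+ (s + i + j))%g.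
rewrite (ldistC (g ^+ (s + i + j))%g) d0i d0s d0e dis die dse; lia.
Qed.

(** The distances from [g ^+ j * p] to 1 and [g ^+ n] are those from [p] to [g ^- j] and
    [g ^+ (n - j)], which lie on the same orbit as the ends of the geodesic. *)
Lemma expg_shift g n j p : j <= n ->
    ldist 1%g p + ldist p (g ^+ n)%g = lnX g n ->
  (ldist 1%g (g ^+ j * p)%g + lnX g n
     <= maxn (lnX g j + ldist p (g ^+ n)%g) (lnX g (n + j) + ldist 1%g p) + D) /\
  (ldist (g ^+ j * p)%g (g ^+ n)%g + lnX g n
     <= maxn (ldist p (g ^+ n)%g + lnX g (n - j)) (ldist 1%g p + lnX g j) + D).
Proof.
move=> jn pn; pose gj := (g ^- j)%g.
have e1 : ldist 1%g (g ^+ j * p)%g = ldist gj p.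
  by rewrite -(ldistMl (g ^+ j) gj) mulgV.
have e2 : ldist (g ^+ j * p)%g (g ^+ n)%g = ldist p (g ^+ (n - j))%g.
  by rewrite -{1}(subnKC jn) expgnDr ldistMl.
have e3 : ldist gj 1%g = lnX g j by rewrite ldistx1 lnV.
have e4 : ldist gj (g ^+ n)%g = lnX g (n + j).
  by rewrite /ldist invgK -expgnDr addnC.
have e5 : ldist 1%g (g ^+ n)%g = lnX g n by rewrite ldist1.
have e6 : ldist (g ^+ (n - j))%g (g ^+ n)%g = lnX g j by rewrite -{2}(subnK jn) ldist_exp.
have e7 : ldist 1%g (g ^+ (n - j))%g = lnX g (n - j) by rewrite ldist1.
have := four_point gj 1%g p (g ^+ n)%g.
have := four_point p 1%g (g ^+ (n - j))%g (g ^+ n)%g.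
rewrite e1 e2 e3 e4 e5 e6 e7 (ldistC p 1%g); lia.
Qed.

(* If all the early powers of g shifted a long orbit segment by at most K, they
   would all move two distant points in its middle by a bounded amount.  Taking
   for s the last visit to a large ball makes the shifts nonnegative. *)
Lemma escape_along_orbit K : exists2 N, 0 < N & forall g, linear_orbit g ->
  forall J, exists s,
  [/\ forall x : nat, x <= J -> lnX g s <= lnX g (s + x),
      forall x y : nat, x <= J -> y <= J ->
        (lnX g (s + x + y) + lnX g s <= lnX g (s + x) + lnX g (s + y) + D) /\
        (lnX g (s + x) + lnX g (s + y) <= lnX g (s + x + y) + lnX g s + D)
    & forall x : nat, N <= x <= J -> lnX g s + K <= lnX g (s + x)].
Proof.
have [r [N acyl]] := ldist_acylindrical (K + 3 * D).
exists N.+1 => // g glox J.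
pose Z := (J + N) * ln g.
have aZ (x : nat) : x <= J + N -> lnX g x <= Z.
  by move=> h; apply: leq_trans (ln_exp_le _ _) _; rewrite leq_mul2r h orbT.
(* [T] dominates all short powers and leaves room, in the middle of the geodesic to [g ^+ s], for
   two points at distance [r]. *)
have [T TE] : exists T, T = 4 * (Z + r + D + K) + ln g + 1 by eexists.
have [s sT sbig] := last_visit T glox.
have asT : T <= lnX g s + ln g.
  have := ln_exp_triangle g s 1; have := sbig s.+1 (leqnn _).
  by rewrite addn1 expg1; lia.
have mono (x : nat) : lnX g s <= lnX g (s + x).
  case: x => [|x]; first by rewrite addn0.
  by apply: leq_trans sT (ltnW (sbig _ _)); lia.
have qadd (x y : nat) : x <= J + N -> y <= J + N ->
        (lnX g (s + x + y) + lnX g s <= lnX g (s + x) + lnX g (s + y) + D) /\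
        (lnX g (s + x) + lnX g (s + y) <= lnX g (s + x + y) + lnX g s + D).
  move=> xJ yJ; have := expg_four_point g s x y.
  have := aZ _ xJ; have := aZ _ yJ; have := mono x; have := mono y.
  by have := mono (x + y); rewrite addnA; lia.
exists s; split=> [x _|x y xJ yJ|]; [exact: mono|by apply: qadd; lia|].
(* A shift above [K + D] propagates to all later powers by monotonicity and almost additivity.
   Otherwise [N + 1] distinct powers barely move two distant points, which is absurd. *)
have [/hasP[j]|/hasPn noj] := boolP (has (fun j => lnX g s + K + D < lnX g (s + j)) (iota 0 N.+1)).
  rewrite mem_iota => jN sj x /andP[Nx xJ].
  have := qadd j (x - j); rewrite -addnA subnKC; last lia.
  have := mono (x - j); lia.
have sN : N < s.
  by rewrite ltnNge; apply/negP => h; have := aZ s; lia.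
have step p : ldist 1%g p + ldist p (g ^+ s)%g = lnX g s -> Z <= ldist 1%g p ->
    Z + ldist 1%g p + D <= lnX g s -> forall j, j <= N -> ldist p (g ^+ j * p)%g <= K + 3 * D.
  move=> pg Zp pZ j jN; have js : j <= s by lia.
  have [h1 h2] := expg_shift js pg.
  have /noj : j \in iota 0 N.+1 by rewrite mem_iota; lia.
  (* This bounds [lnX g (s - j)], hence the distance from the shifted point to the far end. *)
  have [+ _] := expg_four_point g (s - j) j j; rewrite subnK // => h3.
  have := aZ j; move: h3; have := mono j; rewrite -leqNgt => m h3 aj sj.
  have -> : K + 3 * D = (K + 2 * D) + D by lia.
  apply: (@ldist_near 1%g (g ^+ s)%g); first by rewrite pg ldist1.
    lia.
  lia.
have [|p p1 p2] := @ldist_geodesic 1%g (g ^+ s)%g Z; first by rewrite ldist1; lia.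
have [|q q1 q2] := @ldist_geodesic 1%g (g ^+ s)%g (Z + r).
  by rewrite ldist1; lia.
rewrite ldist1 in p2 q2.
have rpq : r <= ldist p q by have := ldist_triangle p 1%g q; rewrite p1 q1; lia.
have [|i [j [ij jN /(linear_orbit_inj glox)]]] := acyl p q rpq (fun i => (g ^+ i)%g).
  move=> i iN; split; apply: step => //; rewrite ?p1 ?q1 ?p2 ?q2; lia.
lia.
Qed.

(* As M does not depend on g, this is a uniform positive lower bound on stable
   translation lengths. *)
Lemma uniform_escape K : exists2 M, 0 < M & forall g, linear_orbit g ->
  forall i r, M <= r -> ln (g ^+ i)%g + K <= ln (g ^+ (i + r))%g.
Proof.
have [N N0 esc] := escape_along_orbit (K + 5 * D + 1).
exists N => // g /esc {}esc i r Nr.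
have [s] := esc (i + r); rewrite /= => -[mono qadd far].
have := mono i; have := mono r; have := mono (i + r).
have := far r; have := far (i + r).
have := qadd i r; have := qadd r i.
(* Comparison with the remote point [g ^+ (s + i + r)] transfers the growth past [s] to the
   exponents [i] and [i + r] themselves. *)
have := @four_point 1%g (g ^+ r)%g (g ^+ (i + r))%g (g ^+ (s + i + r))%g.
have := @four_point 1%g (g ^+ i)%g (g ^+ (i + r))%g (g ^+ (s + i + r))%g.
have := @four_point 1%g (g ^+ r)%g (g ^+ (s + i + r))%g (g ^+ (i + r))%g.
have := @four_point 1%g (g ^+ i)%g (g ^+ (s + i + r))%g (g ^+ (i + r))%g.
rewrite !(ldistC (g ^+ (s + i + r))%g) !ldist1.
have -> : ldist (g ^+ i)%g (g ^+ (i + r))%g = lnX g r by rewrite ldist_exp.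
have -> : ldist (g ^+ r)%g (g ^+ (i + r))%g = lnX g i by rewrite (addnC i) ldist_exp.
have -> : ldist (g ^+ i)%g (g ^+ (s + i + r))%g = lnX g (s + r).
  by rewrite (addnC s) -addnA ldist_exp.
have -> : ldist (g ^+ r)%g (g ^+ (s + i + r))%g = lnX g (s + i).
  by rewrite (addnC (s + i)) ldist_exp.
have -> : ldist (g ^+ (i + r))%g (g ^+ (s + i + r))%g = lnX g s.
  by rewrite -addnA (addnC s) ldist_exp.
rewrite !addnA (addnAC s r i); lia.
Qed.

Definition escapes M K g := forall i r, M <= r -> lnX g i + K <= lnX g (i + r).

Lemma escapes_iter M K g q i r : escapes M K g -> 0 < q -> M * q <= r ->
  lnX g i + K * q <= lnX g (i + r).
Proof.
move=> gM; elim: q i r => // -[|q] IH i r _ qr; first by rewrite !muln1 in qr *; exact: gM.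
rewrite mulnS in qr; have := gM i M (leqnn M); have := IH (i + M) (r - M) isT.
by rewrite -addnA subnKC ?(mulnS K q.+1); lia.
Qed.

Lemma escapes_linear M g i r q : escapes M D.+1 g -> M * q.+1 <= r ->
  lnX g i + q < lnX g (i + r).
Proof.
by move=> gM qr; have := escapes_iter i gM (ltn0Sn q) qr; nia.
Qed.

(** For [s] at least [M], the pairing of [i] with [j] in [expg_four_point] is too small to
    matter. *)
Lemma escapes_quasi_additive M g s i j : escapes M D.+1 g -> M <= s ->
  (lnX g (s + i + j) + lnX g s <= lnX g (s + i) + lnX g (s + j) + D) /\
  (lnX g (s + i) + lnX g (s + j) <= lnX g (s + i + j) + lnX g s + D).
Proof.
move=> gM Ms; have := expg_four_point g s i j; have := gM i s Ms; have := gM j s Ms.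
rewrite (addnC i) (addnC j); lia.
Qed.

(** * Elements commuting with a loxodromic element *)

(** The centralizer of [g] stays close to the powers of [g]: the point is that [e] does not depend
    on [h]. *)
Lemma commuting_near_powers g : linear_orbit g -> exists e, forall h, commute g h ->
  exists u n, ln (g ^- n * (g ^+ u * h))%g <= e.
Proof.
move=> glox; have [M M0 /(_ g glox) gM] := uniform_escape D.+1.
exists (2 * lnX g M + ln g + 4 * D) => h gh.
have gX k : ((g ^+ k) * h = h * (g ^+ k))%g by rewrite (commuteX k (commute_sym gh)).
pose Z := M * (ln g + ln h + 1).+1.
pose n := M * (Z * ln g + ln h + 2 * D).+1 + M.
have [Mn nM] : M <= n /\ M * (Z * ln g + ln h + 2 * D).+1 <= n by rewrite /n; lia.
clearbody n.
have a_n : Z * ln g + ln h + 2 * D < lnX g n.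
  by have := escapes_linear 0 gM nM; rewrite expg0 ln1.
have a_2n := gM n n Mn.
have a_uh u : lnX g u <= ln (g ^+ u * h)%g + ln h.
  by rewrite -{1}(mulgK h (g ^+ u)) -(lnV h); exact: lnM.
have exu : exists u, lnX g n <= ln (g ^+ u * h)%g.
  exists (n + M * (ln h).+1); have := escapes_linear n gM (leqnn (M * (ln h).+1)).
  by have := a_uh (n + M * (ln h).+1); lia.
(* Minimality of [u] makes the length of [g ^+ u * h] agree with [lnX g n] up to [ln g]. *)
case: (ex_minnP exu) => u u_n u_min; exists u, n.
case: u u_n u_min => [|u] u_n u_min; first by rewrite expg0 mul1g in u_n; lia.
have u_lt : ln (g ^+ u.+1 * h)%g < lnX g n + ln g.
  rewrite expgS -mulgA; apply: leq_ltn_trans (lnM _ _) _.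
  rewrite addnC ltn_add2r ltnNge; apply/negP => /u_min; lia.
move: u.+1 u_n u_lt => {u_min}{}u u_n u_lt.
set e := (g ^- n * _)%g.
(* A crude bound that still depends on [h]; [n] was chosen beyond it, so [e] is short compared with
   [g ^+ n]. *)
have e_le : ln e <= Z * ln g + ln h.
  have [nu|/ltnW un] := leqP n u.
    have uZ : u - n < Z.
      rewrite ltnNge; apply/negP => h1; have := escapes_linear n gM h1.
      by rewrite subnKC //; have := a_uh u; lia.
    rewrite /e -{1}(subnKC nu) expgnDr -mulgA mulKg.
    apply: leq_trans (lnM _ _) _; rewrite leq_add2r.
    by apply: leq_trans (ln_exp_le _ _) _; rewrite leq_mul2r (ltnW uZ) orbT.
  have uZ : n - u < Z.
    rewrite ltnNge; apply/negP => h1; have := escapes_linear u gM h1.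
    rewrite subnKC //; have : ln (g ^+ u * h)%g <= lnX g u + ln h by exact: lnM.
    lia.
  rewrite /e -{1}(subnKC un) expgnDr invgM -mulgA mulKg.
  apply: leq_trans (lnM _ _) _; rewrite leq_add2r lnV.
  by apply: leq_trans (ln_exp_le _ _) _; rewrite leq_mul2r (ltnW uZ) orbT.
have gne : (g ^+ n * e = g ^+ u * h)%g by rewrite mulVKg.
have eg : (e * g ^+ n = g ^+ u * h)%g.
  rewrite -gne; apply/commute_sym/commuteM; first exact/commuteV/commute_refl.
  by apply: commuteM; [apply: commuteX2; exact: commute_refl|exact: gX].
have d1 : ldist e (g ^+ u * h)%g = lnX g n by rewrite -eg /ldist mulKg.
have d2 : ldist (g ^+ n)%g (g ^+ u * h)%g = ln e by rewrite -gne /ldist mulKg.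
have d3 : ldist (g ^+ (n + n))%g (g ^+ u * h)%g = ldist (g ^+ n)%g e.
  by rewrite -gne expgnDr ldistMl.
(* Since [e] commutes with [g ^+ n], the quadrilateral 1, [g ^+ n], [g ^+ n * e], [e] has equal
   opposite sides, which bounds the distance from [e] to [g ^+ n]. The point [g ^+ (n + n)] then
   bounds [ln e] independently of [h]. *)
have := four_point 1%g (g ^+ n)%g (g ^+ u * h)%g e.
have := four_point 1%g (g ^+ n)%g (g ^+ (n + n))%g (g ^+ u * h)%g.
rewrite !ldist1 ldist_exp (ldistC (g ^+ u * h)%g e) d1 d2 d3.
have := escapes_quasi_additive (n - M) (n - M) gM (leqnn M).
have := gM (M + (n - M) + (n - M)) M (leqnn M).
have -> : M + (n - M) + (n - M) + M = n + n by lia.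
rewrite subnKC //; lia.
Qed.

(** Powers of [g] correct each [f ^+ k] to an element moving 1 by at most [e]. It commutes with [g],
    so it moves [g ^+ S] equally little; acylindricity makes two of these elements equal. *)
Lemma commuting_commensurable g f : linear_orbit g -> linear_orbit f -> commute g f ->
  exists a b, 0 < b /\ (f ^+ b = g ^+ a \/ f ^+ b = g ^- a)%g.
Proof.
move=> glox flox gf; have [e near] := commuting_near_powers glox.
have [r [N acyl]] := ldist_acylindrical e.
have gX k : commute g (f ^+ k)%g by exact: commuteX.
have [u /choice[v uv]] := choice (fun k => near _ (gX k)).
pose F k := (g ^- v k * (g ^+ u k * f ^+ k))%g.
have gF s k : commute (g ^+ s)%g (F k).
  apply: commuteM; first by apply/commuteV/commuteX2/commute_refl.
  by apply: commuteM; [exact/commuteX2/commute_refl|apply/commuteX2].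
have [S Sr] : exists S, r <= lnX g S.
  by case: glox => A gA; exists (A * r).+1; have := gA (A * r).+1; nia.
have [|i|i [j [ij jN]]] := acyl 1%g (g ^+ S)%g _ F.
- by rewrite ldist1.
- by move=> _; rewrite mulg1 ldist1 /ldist -(gF S i) mulKg; split; exact: uv.
have vF k : (g ^+ v k * F k = g ^+ u k * f ^+ k)%g by rewrite mulVKg.
move=> Fij; have e_fk : (g ^+ (v j + u i) = g ^+ (v i + u j) * f ^+ (j - i))%g.
  apply: (mulIg (f ^+ i)%g); rewrite -[RHS]mulgA -expgnDr subnK; last exact: ltnW.
  by rewrite !expgnDr -!mulgA -!vF Fij !mulgA -!expgnDr addnC.
have [le|/ltnW le] := leqP (v i + u j) (v j + u i).
  exists (v j + u i - (v i + u j)), (j - i); split; [lia|left].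
  by apply: (mulgI (g ^+ (v i + u j))%g); rewrite -e_fk -expgnDr subnKC.
exists (v i + u j - (v j + u i)), (j - i); split; [lia|right].
apply: (mulgI (g ^+ (v i + u j))%g); rewrite -e_fk; have := subnKC le.
by move: (v i + u j - _) => x <-; rewrite [in RHS]expgnDr mulgK.
Qed.

(** * Powers acting on geodesics *)

(** In the middle of the geodesic to [g ^+ n], the element [g ^+ j] acts almost as a translation by
    [lnX g (n + j) - lnX g n]. The last two hypotheses keep [p] and [q] off the parts before and
    after the axis. *)
Lemma shift_along_geodesic M g n j p q : escapes M D.+1 g -> j + M <= n ->
    ldist 1%g p + ldist p (g ^+ n)%g = lnX g n ->
    ldist 1%g q + ldist q (g ^+ n)%g = lnX g n ->
    ldist 1%g q + lnX g n = ldist 1%g p + lnX g (n + j) ->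
    lnX g M <= 2 * ldist 1%g p -> 2 * ldist 1%g q + lnX g M + D <= 2 * lnX g n ->
  ldist (g ^+ j * p)%g q <= 3 * D.
Proof.
move=> gM jn pg qg pq pM qM; have j_le : j <= n by lia.
have [h1 h2] := expg_shift j_le pg.
have := escapes_quasi_additive (n - M) j gM (leqnn M).
have := gM j M (leqnn M).
have [|+ +] := @escapes_quasi_additive M g (n - j) j j gM; first lia.
rewrite subnK // (addnC j) subnKC; last lia.
move=> h3 h4 h5 h6; rewrite ldistC.
have -> : 3 * D = 2 * D + D by lia.
apply: (@ldist_near 1%g (g ^+ n)%g); first by rewrite qg ldist1.
  lia.
lia.
Qed.

(** The last hypothesis puts [p] before the axis, where the geodesics from 1 to [g ^+ m] and to
    [g ^- m] still run together. Since [g ^+ m] carries the latter to a geodesic from [g ^+ m] back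
    to 1, it reverses this part. *)
Lemma flip_geodesic g m p q :
    ldist 1%g p + ldist p (g ^+ m)%g = lnX g m ->
    ldist 1%g q + ldist q (g ^+ m)%g = lnX g m ->
    ldist 1%g p + ldist 1%g q = lnX g m ->
    lnX g (m + m) + 2 * ldist 1%g p <= 2 * lnX g m ->
  ldist (g ^+ m * p)%g q <= 2 * D.
Proof.
move=> pg qg pq pm; have [h1 h2] := expg_shift (leqnn m) pg.
rewrite ldistC; have -> : 2 * D = D + D by lia.
apply: (@ldist_near 1%g (g ^+ m)%g); first by rewrite qg ldist1.
  lia.
by move: h2; rewrite subnn expg0 ln1; lia.
Qed.

Lemma geodesics_near y z p q :
    ldist 1%g p + ldist p y = ln y -> ldist 1%g q + ldist q z = ln z ->
    ldist 1%g p = ldist 1%g q -> ldist 1%g p + ldist y z <= ln y ->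
  ldist p q <= 2 * D.
Proof.
move=> py qz pq pyz.
have := four_point p 1%g z y; rewrite ldist1 => h1.
have := four_point p 1%g q z; rewrite ldist1 => h2.
by move: h1 h2; rewrite ldist1 (ldistC p 1%g) (ldistC z y); lia.
Qed.

Lemma escapes_weaken M K K' g : K' <= K -> escapes M K g -> escapes M K' g.
Proof. by move=> KK gM i r /(gM i); apply: leq_trans; rewrite leq_add2l. Qed.

(** Between [M] and [n] there is room for [q] shifts by [j], all of nearly the same size, so one of
    them uses at most a fraction [2 / q] of the available length. Escape by more than [3 * D] lets
    the factor 2 absorb the errors. *)
Lemma escapes_many_shifts M g n j q : escapes M (3 * D).+1 g ->
    M <= j -> M + q * j + M <= n ->
  q * lnX g (n + j) <= q * lnX g n + 2 * (lnX g n - lnX g M) /\ lnX g M + q <= lnX g n.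
Proof.
move=> gM Mj; have gM' : escapes M D.+1 g by apply: escapes_weaken gM; lia.
move=> n_ge.
have iter_shift k : lnX g M + k * lnX g (M + j) <= lnX g (M + k * j) + k * (lnX g M + D).
  elim: k => [|k IH]; first by rewrite !mul0n !addn0.
  have [_] := escapes_quasi_additive (k * j) j gM' (leqnn M).
  have -> : M + k.+1 * j = M + k * j + j by lia.
  by rewrite !mulSn; lia.
have := iter_shift q; have := gM (M + q * j) (n - (M + q * j)).
rewrite subnKC; last lia.
have [+ _] := escapes_quasi_additive (n - M) j gM' (leqnn M).
rewrite subnKC; last lia.
have := gM M j Mj.
move: (lnX g n) (lnX g M) (lnX g (n + j)) (lnX g (M + j)) (lnX g (M + q * j)) => an aM anj aMj aq.
move=> h1 h2 h3 h4; have {}h3 : aq <= an by lia.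
split; last by nia.
have e1 : q * (anj + aM) <= q * (an + aMj + D) by rewrite leq_mul2l h2 orbT.
have e2 : q * (aM + 3 * D) <= q * aMj by rewrite leq_mul2l; lia.
by rewrite !mulnDr in e1 e2 h4; lia.
Qed.

Definition acylindrical_at e r N := forall x y, r <= ldist x y -> forall F : nat -> G,
  (forall i, i <= N -> ldist x (F i * x)%g <= e /\ ldist y (F i * y)%g <= e) ->
  exists i j, [/\ i < j, j <= N & F i = F j].

Lemma geodesic_param g : exists P : nat -> G, forall t, t <= ln g ->
  ldist 1%g (P t) = t /\ ldist 1%g (P t) + ldist (P t) g = ln g.
Proof.
suff /choice[P PP] : forall t, exists p, t <= ln g ->
  ldist 1%g p = t /\ ldist 1%g p + ldist p g = ln g by exists P.
move=> t; have [tg|] := leqP t (ln g); last by exists 1%g; lia.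
have [|p p1 p2] := @ldist_geodesic 1%g g t; first by rewrite ldist1.
by exists p => _; rewrite p1 p2 ldist1 subnKC.
Qed.

Lemma geodesic_param_far g P t u :
    (forall t, t <= ln g ->
      ldist 1%g (P t) = t /\ ldist 1%g (P t) + ldist (P t) g = ln g) ->
  t + u <= ln g -> u <= ldist (P t) (P (t + u)).
Proof.
move=> PP tu; have := ldist_triangle (P t) 1%g (P (t + u)).
have [|-> _] := PP t; first lia.
by rewrite (proj1 (PP (t + u) tu)); lia.
Qed.

(** * Two axes with a long overlap *)

Section Overlap.
Variables (M N r J : nat) (c d : G) (n m : nat).
Let L := ldist (c ^+ n)%g (d ^+ m)%g.
Hypothesis acyl : acylindrical_at (20 * D) r N.
Hypothesis cM : escapes M D.+1 c.
Hypothesis dM : escapes M D.+1 d.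
Hypothesis M_gt0 : 0 < M.
Hypothesis Jn : J + M <= n.
Hypothesis Mm : M + M <= m.
Hypothesis cJ : forall i, i <= N ->
  M * i <= J /\ lnX c n <= lnX c (n + M * i) <= lnX c (n + J).

Let shift_c (P : nat -> G) : (forall t, t <= lnX c n ->
     ldist 1%g (P t) = t /\ ldist 1%g (P t) + ldist (P t) (c ^+ n)%g = lnX c n) ->
  forall i t, i <= N -> lnX c M <= 2 * t ->
    2 * (t + (lnX c (n + M * i) - lnX c n)) + lnX c M + D <= 2 * lnX c n ->
  ldist (c ^+ (M * i) * P t)%g (P (t + (lnX c (n + M * i) - lnX c n))) <= 3 * D.
Proof.
move=> PP i t iN tM ti; have [iJ /andP[c1 _]] := cJ iN.
have [|p1 p2] := PP t; first lia.
have [|q1 q2] := PP (t + (lnX c (n + M * i) - lnX c n)); first lia.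
by apply: (shift_along_geodesic cM (n := n)) => //; lia.
Qed.

Let d_close (P Q : nat -> G) : (forall t, t <= lnX c n ->
     ldist 1%g (P t) = t /\ ldist 1%g (P t) + ldist (P t) (c ^+ n)%g = lnX c n) ->
   (forall t, t <= lnX d m ->
     ldist 1%g (Q t) = t /\ ldist 1%g (Q t) + ldist (Q t) (d ^+ m)%g = lnX d m) ->
  forall t, t + L <= lnX c n -> t <= lnX d m -> ldist (P t) (Q t) <= 2 * D.
Proof.
move=> PP QQ t tc td.
have [|p1 p2] := PP t; first lia.
have [//|q1 q2] := QQ t.
by apply: (geodesics_near p2 q2); rewrite p1 ?q1.
Qed.

(** On the common stretch, [c ^+ (M * i)] and [d ^+ M] both act almost as translations, so their
    commutators [F i] barely move [P t] and [P (t + r)]. Two equal commutators give the commuting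
    powers. The position [s] is the farthest one reached. *)
Lemma overlap_commute t (s := t + r + (lnX d (m + M) - lnX d m) + (lnX c (n + J) - lnX c n)) :
    lnX c M <= 2 * t -> lnX d M <= 2 * t ->
    2 * s + lnX c M + D <= 2 * lnX c n -> 2 * s + lnX d M + D <= 2 * lnX d m ->
    s + L <= lnX c n ->
  exists2 k, 0 < k & commute (c ^+ k)%g (d ^+ M)%g.
Proof.
move=> ct dt cs ds sL.
have [P PP] := geodesic_param (c ^+ n)%g; have [Q QQ] := geodesic_param (d ^+ m)%g.
have PQ := d_close PP QQ; have cP := shift_c PP.
have dm : lnX d m <= lnX d (m + M) by have := dM m (leqnn M); lia.
pose b := lnX d (m + M) - lnX d m; rewrite -/b in s cs ds sL.
have dP u : lnX d M <= 2 * u -> u + b <= s -> ldist (d ^+ M * P u)%g (P (u + b)) <= 7 * D.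
  move=> Mu us.
  have h1 : ldist (d ^+ M * P u)%g (d ^+ M * Q u)%g <= 2 * D by rewrite ldistMl PQ; lia.
  have h3 : ldist (P (u + b)) (Q (u + b)) <= 2 * D by rewrite PQ; lia.
  have h2 : ldist (d ^+ M * Q u)%g (Q (u + b)) <= 3 * D.
    have [|p1 p2] := QQ u; first lia.
    have [|q1 q2] := QQ (u + b); first lia.
    by apply: (shift_along_geodesic dM (n := m)) => //; lia.
  have := ldist_triangle (d ^+ M * Q u)%g (d ^+ M * P u)%g (P (u + b)).
  have := ldist_triangle (Q (u + b)) (d ^+ M * Q u)%g (P (u + b)).
  by rewrite (ldistC (Q _) (P _)); lia.
pose F i := ((d ^- M) ^ (c ^+ (M * i)) * d ^+ M)%g.
(* Both orders of the two translations lead near [P (u + b + ci')]; the errors add up to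
   [(3 + 7 + 7 + 3) * D]. *)
have moved u : t <= u <= t + r -> forall i, i <= N -> ldist (P u) (F i * P u)%g <= 20 * D.
  move=> tu i iN; have [_ ci] := cJ iN.
  pose ci' := lnX c (n + M * i) - lnX c n.
  set C := (c ^+ (M * i))%g; set A := (d ^+ M)%g.
  have -> : ldist (P u) (F i * P u)%g = ldist (A * (C * P u))%g (C * (A * P u))%g.
    by rewrite -(ldistMl (A * C)) /F /conjg -/C -/A -!mulgA mulVKg mulVKg.
  have h1 : ldist (A * (C * P u))%g (A * P (u + ci'))%g <= 3 * D.
    by rewrite ldistMl; apply: cP => //; lia.
  have h2 : ldist (A * P (u + ci'))%g (P (u + b + ci')) <= 7 * D.
    by rewrite addnAC; apply: dP; rewrite /s; lia.
  have h3 : ldist (C * (A * P u))%g (C * P (u + b))%g <= 7 * D.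
    by rewrite ldistMl; apply: dP; rewrite /s; lia.
  have h4 : ldist (C * P (u + b))%g (P (u + b + ci')) <= 3 * D.
    by apply: cP => //; rewrite /s in cs; lia.
  have := ldist_triangle (A * P (u + ci'))%g (A * (C * P u))%g (C * (A * P u))%g.
  have := ldist_triangle (P (u + b + ci')) (A * P (u + ci'))%g (C * (A * P u))%g.
  have := ldist_triangle (C * P (u + b))%g (C * (A * P u))%g (P (u + b + ci')).
  by rewrite (ldistC (P _) (C * (A * P u))%g); lia.
have [||i [j [ij jN Fij]]] := acyl (x := P t) (y := P (t + r)) _ (F := F).
- by apply: (geodesic_param_far PP); lia.
- by move=> i iN; split; apply: moved => //; lia.
exists (M * (j - i)); first by rewrite muln_gt0 M_gt0 subn_gt0.
move/mulIg: Fij => Fij; apply/commute_sym.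
have : commute (c ^+ (M * (j - i)))%g (d ^- M)%g.
  have := subnK (ltnW ij); move: (j - i) => k kE.
  move: Fij; rewrite -kE mulnDr expgnDr conjgM => /conjg_inj e.
  by apply: commute_sym; rewrite /commute conjgC -e.
by move/commuteV; rewrite invgK => /commute_sym.
Qed.

(** Here [d ^+ m] reverses a stretch along which [c] translates, so the conjugate of [c ^+ (M * i)]
    nearly undoes [c ^+ (M * i)]. Two equal products [F i] make it an exact inverse for some
    exponent. *)
Lemma overlap_flip t (s := t + r + (lnX c (n + J) - lnX c n)) :
    lnX c M + D + 2 * L <= 2 * t -> 2 * L <= t ->
    2 * s + lnX c M + D <= 2 * lnX c n ->
    lnX d (m + m) + 2 * s <= 2 * lnX d m ->
    lnX c M + 2 * s <= 2 * lnX d m -> s + L <= lnX c n ->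
  exists2 k, 0 < k & ((c ^+ k) ^ (d ^+ m))%g = (c ^- k)%g.
Proof.
move=> ct Lt cs ds cds sL.
have [P PP] := geodesic_param (c ^+ n)%g; have [Q QQ] := geodesic_param (d ^+ m)%g.
have PQ := d_close PP QQ; have cP := shift_c PP.
have cn : lnX c n <= lnX d m + L /\ lnX d m <= lnX c n + L.
  have := ldist_triangle (d ^+ m)%g 1%g (c ^+ n)%g.
  have := ldist_triangle (c ^+ n)%g 1%g (d ^+ m)%g.
  by rewrite !ldist1 (ldistC (d ^+ m)%g) /L; lia.
have dP u : t <= u <= s -> ldist (d ^+ m * P u)%g (P (lnX d m - u)) <= 6 * D.
  move=> Mu.
  have h1 : ldist (d ^+ m * P u)%g (d ^+ m * Q u)%g <= 2 * D by rewrite ldistMl PQ; lia.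
  have h3 : ldist (P (lnX d m - u)) (Q (lnX d m - u)) <= 2 * D by rewrite PQ; lia.
  have h2 : ldist (d ^+ m * Q u)%g (Q (lnX d m - u)) <= 2 * D.
    have [|p1 p2] := QQ u; first lia.
    have [|q1 q2] := QQ (lnX d m - u); first lia.
    by apply: flip_geodesic => //; lia.
  have := ldist_triangle (d ^+ m * Q u)%g (d ^+ m * P u)%g (P (lnX d m - u)).
  have := ldist_triangle (Q (lnX d m - u)) (d ^+ m * Q u)%g (P (lnX d m - u)).
  by rewrite (ldistC (Q _) (P _)); lia.
pose F i := ((c ^+ (M * i)) ^ (d ^+ m) * c ^+ (M * i))%g.
(* Both paths end near [P (lnX d m - u)], with total error [(3 + 6 + 3 + 6) * D]. *)
have moved u : t <= u <= t + r -> forall i, i <= N -> ldist (P u) (F i * P u)%g <= 20 * D.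
  move=> tu i iN; have [_ ci] := cJ iN.
  pose ci' := lnX c (n + M * i) - lnX c n.
  set C := (c ^+ (M * i))%g; set B := (d ^+ m)%g.
  have -> : ldist (P u) (F i * P u)%g = ldist (B * P u)%g (C * (B * (C * P u)))%g.
    by rewrite -(ldistMl B) /F /conjg -/C -/B -!mulgA mulVKg.
  have h1 : ldist (C * (B * (C * P u)))%g (C * (B * P (u + ci')))%g <= 3 * D.
    by rewrite !ldistMl; apply: cP => //; lia.
  have h2 : ldist (C * (B * P (u + ci')))%g (C * P (lnX d m - (u + ci')))%g <= 6 * D.
    by rewrite ldistMl; apply: dP; rewrite /s; lia.
  have h3 : ldist (C * P (lnX d m - (u + ci')))%g (P (lnX d m - u)) <= 3 * D.
    have -> : lnX d m - u = lnX d m - (u + ci') + ci' by lia.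
    by apply: cP => //; lia.
  have h4 : ldist (B * P u)%g (P (lnX d m - u)) <= 6 * D by apply: dP; rewrite /s; lia.
  have := ldist_triangle (P (lnX d m - u)) (B * P u)%g (C * (B * (C * P u)))%g.
  have := ldist_triangle (C * P (lnX d m - (u + ci')))%g (C * (B * (C * P u)))%g
            (P (lnX d m - u)).
  have := ldist_triangle (C * (B * P (u + ci')))%g (C * (B * (C * P u)))%g
            (C * P (lnX d m - (u + ci')))%g.
  by rewrite (ldistC (P _) (C * _)%g); lia.
have [||i [j [ij jN Fij]]] := acyl (x := P t) (y := P (t + r)) _ (F := F).
- by apply: (geodesic_param_far PP); lia.
- by move=> i iN; split; apply: moved => //; lia.
exists (M * (j - i)); first by rewrite muln_gt0 M_gt0 subn_gt0.
have := subnKC (ltnW ij); move: (j - i) => k kE.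
move: Fij; rewrite /F -kE mulnDr {2}addnC !expgnDr conjMg.
move: (_ ^ _)%g (_ ^ _)%g => x y.
rewrite -!mulgA => /mulgI/esym/eqP; rewrite mulgA -{2}(mul1g (c ^+ (M * i))%g).
by move=> /eqP/mulIg/eqP; rewrite mulg_eq1 => /eqP.
Qed.

End Overlap.

(** * Commensurable elements and the equality of their elementary subgroups *)

Lemma E_sub g f a b : 0 < b -> (f ^+ b = g ^+ a \/ f ^+ b = g ^- a)%g ->
  (E_ g `<=` E_ f)%classic.
Proof.
move=> b0 fg x [k k0 gx]; exists (b * k); first by rewrite muln_gt0 b0.
have fbk : (f ^+ (b * k) = g ^+ k ^+ a \/ f ^+ (b * k) = (g ^+ k ^+ a)^-1)%g.
  by case: fg => e; [left|right]; rewrite expgnA e ?expVgn expgnAC.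
have {}gx : ((g ^+ k ^+ a) ^ x = g ^+ k ^+ a \/ (g ^+ k ^+ a) ^ x = (g ^+ k ^+ a)^-1)%g.
  by rewrite conjXg /conjg mulgA; case: gx => ->; [left|right; rewrite expVgn].
rewrite -mulgA -/(conjg _ _).
by case: fbk => ->; rewrite ?conjVg; case: gx => ->; rewrite ?invgK; [left|right|left|right].
Qed.

(** As [f] has infinite order, [a] is positive too, and the relation can be read in both
    directions. *)
Lemma E_eq g f a b : linear_orbit f -> 0 < b -> (f ^+ b = g ^+ a \/ f ^+ b = g ^- a)%g ->
  E_ g = E_ f.
Proof.
move=> flox b0 fg; have a0 : 0 < a.
  case: a fg => // fg; suff : b = 0 by lia.
  by apply: (linear_orbit_inj flox); case: fg => ->; rewrite !expg0 ?invg1.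
apply/seteqP; split; first exact: E_sub b0 fg.
by apply: (E_sub (a := b) a0); case: fg => ->; [left|right; rewrite invgK].
Qed.

Lemma linear_orbitX g k : 0 < k -> linear_orbit g -> linear_orbit (g ^+ k)%g.
Proof. by move=> k0 [A gA]; exists A => i; rewrite -expgnA (leq_trans _ (gA _)) ?leq_pmull. Qed.

Lemma commute_E g f i j : linear_orbit g -> linear_orbit f -> 0 < i -> 0 < j ->
  commute (g ^+ i)%g (f ^+ j)%g -> E_ g = E_ f.
Proof.
move=> glox flox i0 j0 gf.
have [a [b [b0]]] := commuting_commensurable (linear_orbitX i0 glox) (linear_orbitX j0 flox) gf.
rewrite -!expgnA; apply: E_eq => //; first by rewrite muln_gt0 j0.
Qed.

(* The square of f^m commutes with g^k, hence is commensurable with it, so that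
   f^m would invert a power of itself. *)
Lemma no_linear_flip g f k m : linear_orbit g -> linear_orbit f -> 0 < k -> 0 < m ->
  ((g ^+ k) ^ (f ^+ m))%g <> (g ^- k)%g.
Proof.
move=> glox flox k0 m0 flip.
have comm : commute (g ^+ k)%g (f ^+ (m + m))%g.
  by rewrite /commute conjgC expgnDr conjgM flip conjVg flip invgK.
have m2 : 0 < m + m by lia.
have [a [b [b0]]] := commuting_commensurable (linear_orbitX k0 glox) (linear_orbitX m2 flox) comm.
rewrite -expgnA => e; have : ((f ^+ ((m + m) * b)) ^ (f ^+ m) = f ^- ((m + m) * b))%g.
  by case: e => ->; rewrite ?conjVg conjXg flip expVgn ?invgK.
rewrite /conjg -expgnDr addnC expgnDr mulKg => /eqP; rewrite -mulg_eq1 -expgnDr => /eqP fid.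
have : (m + m) * b + (m + m) * b = 0 by apply: (linear_orbit_inj flox); rewrite fid expg0.
by nia.
Qed.

Lemma fellow_travel_E : exists2 N0, 0 < N0 & forall c d n m,
    linear_orbit c -> linear_orbit d ->
    N0 * (ldist (c ^+ n)%g (d ^+ m)%g).+1 <= minn n m -> E_ c = E_ d.
Proof.
have [M M0 escape] := uniform_escape (3 * D).+1.
have [r [N acyl]] := ldist_acylindrical (20 * D).
exists (M + 200 * (r + D).+1 * (M * N.+1) + M); first lia.
move=> c d n m clox dlox.
(* The difference [lnX c n - lnX c M] measures the part of the geodesic along the axis of [c]. By
   symmetry, the axis of [d] takes the shorter part. *)
wlog WdWc : c d n m clox dlox / lnX d m + lnX c M <= lnX c n + lnX d M => [hw|].
  have [|/ltnW] := leqP (lnX d m + lnX c M) (lnX c n + lnX d M); first exact: hw.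
  by rewrite minnC ldistC => h /hw {}hw; apply/esym/hw => //; rewrite addnC [leqRHS]addnC.
set L := ldist _ _ => size_bound.
have cM := escape c clox; have dM := escape d dlox.
have cM1 : escapes M D.+1 c by apply: escapes_weaken cM; lia.
have dM1 : escapes M D.+1 d by apply: escapes_weaken dM; lia.
pose J := M * N.+1; have MJ : M <= J by rewrite /J mulnS; lia.
(* By [escapes_many_shifts], one shift then uses at most a hundredth of the axis part, and both axis
   parts have length at least [Q], far above [L], [r] and [D]. *)
pose Q := 200 * (L + r + D + 1).
have QJ : M + Q * J + M <= minn n m.
  apply: leq_trans size_bound; rewrite -/J /Q; nia.
have QM : M + Q * M + M <= minn n m.
  by apply: leq_trans QJ; rewrite leq_add2r leq_add2l leq_mul2l MJ orbT.
have [c1 c2] : Q * lnX c (n + J) <= Q * lnX c n + 2 * (lnX c n - lnX c M) /\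
    lnX c M + Q <= lnX c n by apply: escapes_many_shifts => //; lia.
have [d1 d2] : Q * lnX d (m + M) <= Q * lnX d m + 2 * (lnX d m - lnX d M) /\
    lnX d M + Q <= lnX d m by apply: escapes_many_shifts => //; lia.
have Q200 : 200 <= Q by rewrite /Q; lia.
have cJ i : i <= N -> M * i <= J /\ lnX c n <= lnX c (n + M * i) <= lnX c (n + J).
  move=> iN; split; first by rewrite leq_mul2l; lia.
  have -> : n + J = n + M * i + M * (N.+1 - i) by rewrite -addnA -mulnDr subnKC //; lia.
  have := cM (n + M * i) (M * (N.+1 - i)); rewrite leq_pmulr; last lia.
  case: i iN => [|i] iN; first by rewrite ?muln0 ?addn0; lia.
  by have := cM n (M * i.+1); rewrite leq_pmulr //; lia.
have Jn : J + M <= n by have := leq_pmull J (leq_trans (isT : 0 < 200) Q200); lia.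
have Mm : M + M <= m by have := leq_pmull M (leq_trans (isT : 0 < 200) Q200); lia.
have bc : 100 * (lnX c (n + J) - lnX c n) <= lnX c n - lnX c M.
  have := leq_mul Q200 (leqnn (lnX c (n + J) - lnX c n)).
  by rewrite (mulnBr Q); lia.
have bd : 100 * (lnX d (m + M) - lnX d m) <= lnX d m - lnX d M.
  have := leq_mul Q200 (leqnn (lnX d (m + M) - lnX d m)).
  by rewrite (mulnBr Q); lia.
have [_ cnJ] := andP (proj2 (cJ N (leqnn N))).
have dmM := dM m M (leqnn M).
have anem : lnX c n <= lnX d m + L /\ lnX d m <= lnX c n + L.
  have := ldist_triangle (d ^+ m)%g 1%g (c ^+ n)%g.
  have := ldist_triangle (c ^+ n)%g 1%g (d ^+ m)%g.
  by rewrite !ldist1 (ldistC (d ^+ m)%g) -/L; lia.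
have m0 : 0 < m by lia.
(* The alternative is whether the axis part of [d] holds two shifts of [c]. If so, the overlap
   starts at [t], where both axes have been reached. *)
have [wide|narrow] := leqP (2 * (lnX c (n + J) - lnX c n)) (lnX d m - lnX d M).
  have [t t1 t2] : exists2 t, maxn (lnX c M) (lnX d M) <= 2 * t &
      2 * t <= maxn (lnX c M) (lnX d M) + 1.
    by exists (maxn (lnX c M) (lnX d M)).+1./2; lia.
  have [k k0] : exists2 k, 0 < k & commute (c ^+ k)%g (d ^+ M)%g.
    by apply: (overlap_commute acyl cM1 dM1 M0 Jn Mm cJ (t := t)); rewrite /= -?/L; lia.
  exact: commute_E.
(* These estimates bound [lnX d (m + m)] from above by about [2 * lnX d m - lnX d M]: the part
   before the axis of [d] has length about half of [lnX d M], almost half of the whole geodesic. *)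
have := escapes_quasi_additive (m - M) (m - M) dM1 (leqnn M).
have [|+ _] := @escapes_quasi_additive M d m (m - M) M dM1; first lia.
rewrite subnKC; last lia.
have -> : m + (m - M) + M = m + m by lia.
have [t t1 t2] : exists2 t, lnX c M + 2 * D + 4 * L <= 2 * t &
      2 * t <= lnX c M + 2 * D + 4 * L + 1.
    by exists (lnX c M + 2 * D + 4 * L).+1./2; lia.
move=> q1 q2.
have [k k0] : exists2 k, 0 < k & ((c ^+ k) ^ (d ^+ m))%g = (c ^- k)%g.
  by apply: (overlap_flip acyl cM1 M0 Jn Mm cJ (t := t)); rewrite /= -?/L; lia.
by move=> /(no_linear_flip clox dlox k0 m0).
Qed.

End HyperbolicLength.

(** * Words and geodesic paths *)

Section WordLength.
Local Open Scope group_scope.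
Local Open Scope nat_scope.
Variables (G : groupType) (X : set G).
Hypothesis X_inv : inv_closed X.
Hypothesis X_gen : generates X.

Local Notation wl := (word_length X).
Local Notation dist := (ldist wl).

Lemma represents_cat v w g h :
  represents X v g -> represents X w h -> represents X (v ++ w) (g * h)%g.
Proof.
move=> [vX <-] [wX <-]; split; last by rewrite big_cat.
by move=> x; rewrite mem_cat => /orP[/vX|/wX].
Qed.

Lemma represents_inv w g : represents X w g ->
  represents X (rev [seq x^-1%g | x <- w]) g^-1%g.
Proof.
move=> [wX <-]; split.
  by move=> x; rewrite mem_rev => /mapP[y /wX /X_inv yX ->].
elim: w {wX} => [|x w IH]; first by rewrite !big_nil invg1.
by rewrite /= rev_cons -cats1 big_cat big_seq1 IH big_cons invgM.
Qed.

Lemma word_length_spec g :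
  (exists2 w, represents X w g & size w = wl g) /\
  (forall w, represents X w g -> wl g <= size w).
Proof.
rewrite /word_length; set S := (S in xget _ S); suff: S (xget 0 S) by [].
apply: xgetPex.
have ex : exists n, `[< exists2 w, represents X w g & size w = n >].
  by have [w wg] := X_gen g; exists (size w); apply/asboolP; exists w.
case: (ex_minnP ex) => n /asboolP wn n_min; exists n; split=> // w wg.
by apply: n_min; apply/asboolP; exists w.
Qed.

Lemma word_length_le w g : represents X w g -> wl g <= size w.
Proof. by case: (word_length_spec g) => _; exact. Qed.

Lemma word_length1 : wl 1%g = 0.
Proof.
apply/eqP; rewrite -leqn0; apply: (@word_length_le [::]).
by split; rewrite ?big_nil.
Qed.

Lemma word_length_eq0 g : wl g = 0 -> g = 1%g.
Proof.
have [[w [_ <-] <-] _] := word_length_spec g.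
by move=> /size0nil ->; rewrite big_nil.
Qed.

Lemma word_lengthV g : wl g^-1%g = wl g.
Proof.
have le h : wl h^-1%g <= wl h.
  have [[w wh <-] _] := word_length_spec h.
  by have := word_length_le (represents_inv wh); rewrite size_rev size_map.
by apply/eqP; rewrite eqn_leq le -{1}(invgK g) le.
Qed.

Lemma word_lengthM g h : wl (g * h)%g <= wl g + wl h.
Proof.
have [[v vg <-] _] := word_length_spec g; have [[w wh <-] _] := word_length_spec h.
by have := word_length_le (represents_cat vg wh); rewrite size_cat.
Qed.

Lemma word_length_gen g : X g -> wl g <= 1.
Proof.
move=> gX; apply: (@word_length_le [:: g]); split; last by rewrite big_seq1.
by move=> x; rewrite inE => /eqP ->.
Qed.

(** The path is continued constantly past its end, so every index carries an edge, possibly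
    degenerate. *)
Definition geodesic_path (u v : G) (P : nat -> G) :=
  [/\ P 0 = u, forall i, dist u v <= i -> P i = v,
      forall i, P i = P i.+1 \/ X ((P i)^-1 * P i.+1)%g
    & forall i j, i <= j <= dist u v -> dist (P i) (P j) = j - i].

Lemma geodesic_path_exists u v : exists P, geodesic_path u v P.
Proof.
have [[w [wX wuv] wn] _] := word_length_spec (u^-1 * v)%g.
rewrite -/(dist u v) in wn.
pose P i := (u * \prod_(x <- take i w) x)%g.
have P0 : P 0 = u by rewrite /P take0 big_nil mulg1.
have Pend i : dist u v <= i -> P i = v.
  by move=> ni; rewrite /P take_oversize ?wn // wuv mulVKg.
have Pij i j : i <= j -> ((P i)^-1 * P j = \prod_(x <- take (j - i) (drop i w)) x)%g.
  move=> ij; rewrite /P take_drop subnK // invgM -mulgA mulKg.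
  by rewrite -[in X in (_ * X)%g](cat_take_drop i (take j w)) big_cat take_takel ?mulKg.
have dP i j : i <= j -> dist (P i) (P j) <= j - i.
  move=> ij; have rP : represents X (take (j - i) (drop i w)) ((P i)^-1 * P j)%g.
    by split; rewrite ?Pij // => x /mem_take/mem_drop/wX.
  by apply: leq_trans (word_length_le rP) _; rewrite size_take; case: ifP; lia.
exists P; split=> //.
- move=> i; have [wi|iw] := leqP (size w) i; [left|right].
    by rewrite (Pend i) ?(Pend i.+1) -?wn //; lia.
  rewrite Pij // subSnn (drop_nth 1%g iw) /= take0 big_seq1.
  by apply: wX; exact: mem_nth.
move=> i j /andP[ij jn]; apply/eqP; rewrite eqn_leq dP //=.
have := ldist_triangle word_lengthM (P i) u v.
have := ldist_triangle word_lengthM (P j) (P i) v.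
have := dP 0 i (leq0n i); have := dP j _ jn.
by rewrite (Pend _ (leqnn _)) P0; lia.
Qed.

Lemma word_geodesic u v t : t <= dist u v ->
  exists2 p, dist u p = t & dist p v = dist u v - t.
Proof.
move=> tn; have [P [P0 Pn _ dP]] := geodesic_path_exists u v.
exists (P t); first by rewrite -{1}P0 dP ?subn0.
by rewrite -{1}(Pn _ (leqnn _)) dP ?tn ?leqnn.
Qed.

End WordLength.

(** * From slim triangles to the four-point condition *)

Section SlimTriangles.
Local Open Scope group_scope.
Local Open Scope nat_scope.
Variables (G : groupType) (X : set G) (delta : nat).
Hypothesis X_inv : inv_closed X.
Hypothesis X_gen : generates X.
Local Notation dist := (ldist (word_length X)).

Definition between (x y p : G) := dist x p + dist p y = dist x y.

(** One chosen geodesic per pair of vertices suffices; the other two sides enter only through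
    distances. *)
Hypothesis slim : forall x y, exists2 P, geodesic_path X x y P &
  forall z i, i <= dist x y ->
    exists2 q, dist (P i) q <= delta & between y z q \/ between z x q.

Let tri x y z := ldist_triangle (word_lengthM X_gen) y x z.
Let symm := ldistC (word_lengthV X_inv X_gen).
Let dist0 x : dist x x = 0.
Proof. by rewrite /ldist mulVg word_length1. Qed.

(** A discrete continuity argument: the path starts near a side from [w] to [a], and the first
    vertex that is not near such a side is near one from [b] to [w]. There the distance to [w] is at
    most the Gromov product of [a] and [b] at [w], up to [2 * delta + 1]. *)
Let gromov_product_realised (a b w : G) (P : nat -> G) : geodesic_path X a b P ->
    (forall i, i <= dist a b ->
       exists2 q, dist (P i) q <= delta & between b w q \/ between w a q) ->
  exists2 i, i <= dist a b &
    2 * dist w (P i) + dist a b <= dist w a + dist w b + 4 * delta + 2.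
Proof.
move=> [P0 Pn _ dP] slimP; pose n := dist a b.
pose near_a i := exists2 q, dist (P i) q <= delta & between w a q.
have [far|] := pselect (exists i, `[< i <= n /\ ~ near_a i >]); last first.
  move=> all_near; have [q] : near_a n.
    by apply: contrapT => nn; apply: all_near; exists n; apply/asboolP.
  rewrite (Pn _ (leqnn _)) => bq wqa; exists n => //; rewrite (Pn _ (leqnn _)).
  have := tri w q b; have := tri b q a.
  by rewrite (symm b a) (symm q b) -wqa -/n; lia.
case: (ex_minnP far) => -[|i] /asboolP[i_n not_near] i_min.
  by case: not_near; exists a; rewrite /between ?P0 dist0 ?addn0.
have [q pq wqa] : near_a i.
  apply: contrapT => nn; have : i.+1 <= i by apply: i_min; apply/asboolP; split=> //; lia.
  by rewrite ltnn.
have [q' pq' [bqw|wqa']] := slimP _ i_n; last by case: not_near; exists q'.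
exists i.+1 => //; have := dP i i.+1; rewrite leqnSn i_n subSnn => /(_ isT) step.
have := tri w q' (P i.+1); have := tri b q' (P i.+1).
have := tri w q (P i); have := tri w (P i) (P i.+1).
have := tri (P i.+1) (P i) a; have := tri (P i) q a; have := tri a (P i.+1) b.
move: wqa bqw; rewrite /between -/n.
rewrite (symm q' (P i.+1)) (symm q (P i)) (symm a (P i.+1)) (symm (P i.+1) (P i)).
by rewrite (symm b q') (symm b w) (symm b (P i.+1)) (symm q' w) step; lia.
Qed.

(** A vertex between [x] and [z] realising the Gromov product at [w] is near a side through [y], and
    passing through it bounds the distance from [y] to [w]. *)
Lemma slim_four_point x y z w : dist x z + dist y w <=
  maxn (dist x y + dist z w) (dist y z + dist x w) + (6 * delta + 2).
Proof.
have [P xzP slimP] := slim x z.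
have [i i_n wp] := gromov_product_realised xzP (slimP w).
have [q pq q_between] := slimP y _ i_n.
have := tri w (P i) q; have := tri w q x; have := tri w q y; have := tri w q z.
move: q_between wp; rewrite /between (symm z w) (symm x w) (symm y w) (symm y z).
by rewrite (symm q x) (symm q y) (symm q z) (symm y x) (symm y q) => -[]; lia.
Qed.

End SlimTriangles.

(** * The geometric realization *)

Section CayleyMetric.
Local Open Scope ring_scope.
Variables (R : realType) (G : groupType) (X : set G).
Hypothesis X_inv : inv_closed X.
Hypothesis X_gen : generates X.
Implicit Types (p q : cayley_point R X) (u v : G).
Local Notation dist := (ldist (word_length X)).

Let tri y x z := ldist_triangle (word_lengthM X_gen) y x z.
Let symm := ldistC (word_lengthV X_inv X_gen).
Let dist0 u : dist u u = 0%N.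
Proof. by rewrite /ldist mulVg word_length1. Qed.
Let dist_eq0 u v : dist u v = 0%N -> u = v.
Proof. by move=> /(word_length_eq0 X_gen)/mulg1_eq; rewrite invgK. Qed.

Lemma vertex_distE u v : vertex_dist R X u v = (dist u v)%:R.
Proof. by []. Qed.

Lemma edge_lengthE p : edge_length p = (dist (src p) (tgt p))%:R.
Proof.
rewrite /edge_length; have [-> |neq] := eqVneq; first by rewrite dist0.
congr (_%:R); apply/eqP; rewrite eqn_leq /= lt0n.
apply/andP; split; first by apply: contra_neq neq => /dist_eq0.
by case: p neq => u v t /= [->|/(word_length_gen X_gen)//] _; rewrite eqxx.
Qed.

Lemma edge_bounds p :
  [/\ 0 <= to_src p, 0 <= to_tgt p & to_src p + to_tgt p = (dist (src p) (tgt p))%:R].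
Proof.
have [p0 p1] := andP (cayley_pos_subproof p).
have e0 : 0 <= edge_length p by rewrite ler0n.
split; first by rewrite mulr_ge0.
  by rewrite mulr_ge0 // subr_ge0.
by rewrite -mulrDl addrC subrK mul1r edge_lengthE.
Qed.

Lemma edge_le1 p : (dist (src p) (tgt p) <= 1)%N.
Proof. by rewrite -(ler_nat R) -edge_lengthE lern1 leq_b1. Qed.

Lemma cayley_distC p q : cayley_dist R X p q = cayley_dist R X q p.
Proof.
rewrite /cayley_dist /dist_via !vertex_distE.
rewrite (eq_sym (src q) (src p)) (eq_sym (tgt q) (tgt p)).
rewrite (eq_sym (src q) (tgt p)) (eq_sym (tgt q) (src p)) andbC.
case: ifP => _; first by rewrite distrC.
rewrite [in RHS]andbC; case: ifP => [/andP[/eqP e1 /eqP e2]|_].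
  have [_ _ ep] := edge_bounds p; have [_ _ eq] := edge_bounds q.
  have : dist (src p) (tgt p) = dist (src q) (tgt q) by rewrite e1 e2 symm.
  move=> /(congr1 (fun k => k%:R : R)); rewrite -ep -eq => e.
  by congr `|_|; lra.
rewrite minACA.
rewrite (symm (src q) (src p)) (symm (tgt q) (tgt p)).
rewrite (symm (src q) (tgt p)) (symm (tgt q) (src p)).
by congr (Num.min (Num.min _ _) (Num.min _ _)); lra.
Qed.

Lemma cayley_dist_src p q :
  (dist (src p) (src q))%:R - 2 <= cayley_dist R X p q <= (dist (src p) (src q))%:R + 2.
Proof.
have [sp tp ep] := edge_bounds p; have [sq tq eq] := edge_bounds q.
have ep1 := edge_le1 p; have eq1 := edge_le1 q.
have := ep1; have := eq1; rewrite -!(ler_nat R) => eq1' ep1'.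
have d1 := tri (tgt q) (src p) (src q).
have d2 := tri (tgt p) (src p) (src q).
have d3 := tri (tgt p) (src p) (tgt q).
rewrite (symm (tgt q) (src q)) in d1.
rewrite -(ler_nat R) natrD in d1; rewrite -(ler_nat R) natrD in d2.
rewrite -(ler_nat R) natrD in d3.
rewrite /cayley_dist /dist_via !vertex_distE.
case: ifP => [/andP[/eqP e1 /eqP e2]|_].
  by rewrite e1 dist0; case: (ger0P (_ - _)); lra.
case: ifP => [/andP[/eqP e1 /eqP e2]|_].
  rewrite e1 (symm (tgt q)); have := ler0n R (dist (src q) (tgt q)).
  by case: (ger0P (_ - _)); lra.
rewrite !le_min !ge_min; apply/andP; split; last by apply/orP; left; apply/orP; left; lra.
by apply/andP; split; apply/andP; split; lra.
Qed.

Lemma cayley_dist_vertices p q : src p = tgt p -> src q = tgt q ->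
  cayley_dist R X p q = (dist (src p) (src q))%:R.
Proof.
move=> ep eq; have [sp tp] := edge_bounds p; have [sq tq] := edge_bounds q.
rewrite -ep -eq !dist0 => e1 e2.
have [z1 z2 z3 z4] : [/\ to_src p = 0, to_tgt p = 0, to_src q = 0 & to_tgt q = 0] by split; lra.
rewrite /cayley_dist /dist_via !vertex_distE -ep -eq z1 z2 z3 z4 !minxx.
rewrite !(oppr0, addr0, add0r, normr0); by case: eqP => //= ->; rewrite dist0.
Qed.

Lemma vertex_pos_subproof : 0 <= (0 : R) <= 1.
Proof. by rewrite lexx ler01. Qed.

Definition cayley_vertex u : cayley_point R X :=
  CayleyPoint (or_introl (erefl u)) vertex_pos_subproof.

Lemma cayley_dist_vertex u v :
  cayley_dist R X (cayley_vertex u) (cayley_vertex v) = (dist u v)%:R.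
Proof. exact: cayley_dist_vertices. Qed.

Definition on_path (P : nat -> G) (s : R) p :=
  let i := Num.truncn s in [/\ src p = P i, tgt p = P i.+1 & pos p = s - i%:R].

Lemma on_path_exists u v P : geodesic_path X u v P -> forall s, 0 <= s ->
  exists p, on_path P s p.
Proof.
move=> [_ _ PX _] s s0; have /andP[si sSi] := truncn_itv s0.
have pos01 : 0 <= s - (Num.truncn s)%:R <= 1 by rewrite -natr1 in sSi; lra.
by exists (CayleyPoint (PX (Num.truncn s)) pos01).
Qed.

(** For points on different edges the shortest route leaves through the target of the first edge and
    enters through the source of the second. *)
Lemma on_path_dist u v P s t p q : geodesic_path X u v P ->
    0 <= s <= t -> t <= (dist u v)%:R -> on_path P s p -> on_path P t q ->
  cayley_dist R X p q = t - s.
Proof.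
move=> [P0 Pn _ dP] /andP[s0 st] tn [sp tp pp] [sq tq pq].
have t0 : 0 <= t by lra.
have /andP[si sSi] := truncn_itv s0; have /andP[tj tSj] := truncn_itv t0.
move: (Num.truncn s) (Num.truncn t) si sSi tj tSj sp tp pp sq tq pq.
move=> i j si sSi tj tSj sp tp pp sq tq pq.
set n := dist u v in Pn dP tn.
have jn : (j <= n)%N by rewrite -(ler_nat R); lra.
have ij : (i <= j)%N by rewrite -ltnS -(ltr_nat R); lra.
have [sp0 tp0 ep] := edge_bounds p; have [sq0 tq0 eq] := edge_bounds q.
have ppE : to_src p = (s - i%:R) * (dist (P i) (P i.+1))%:R.
  by rewrite /to_src edge_lengthE pp sp tp.
have pqE : to_src q = (t - j%:R) * (dist (P j) (P j.+1))%:R.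
  by rewrite /to_src edge_lengthE pq sq tq.
rewrite sp tp in ep; rewrite sq tq in eq.
rewrite -natr1 in sSi; rewrite -natr1 in tSj.
have step k : (k < n)%N -> dist (P k) (P k.+1) = 1%N.
  by move=> kn; rewrite dP ?leqnSn // subSnn.
have jS : (n <= j)%N -> P j.+1 = P j by move=> nj; rewrite !Pn // leqW.
have dPR k l : (k <= l)%N -> (l <= n)%N -> (dist (P k) (P l))%:R = l%:R - k%:R :> R.
  by move=> kl ln; rewrite dP ?kl // natrB.
have dij k : (i < k)%N -> (k <= n)%N -> (P i == P k) = false.
  move=> ik kn; apply/eqP => e; have := dP i k; rewrite e dist0 kn (ltnW ik) => /(_ isT).
  by move=> /esym/eqP; rewrite subn_eq0 leqNgt ik.
case: (ltngtP i j) ij => // ij' _.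
  have i_n : (i < n)%N := leq_trans ij' jn.
  rewrite (step _ i_n) mulr1 in ppE; rewrite (step _ i_n) in ep.
  have iSj : i%:R + 1 <= j%:R :> R by rewrite natr1 ler_nat.
  (* For [j = n] the edge of [q] is degenerate, whence the case distinction. *)
  have [tgt_ij tgt_iSj src_j nij] : [/\ t - i%:R <= (dist (P i) (P j.+1))%:R + to_tgt q,
      t - i%:R - 1 <= (dist (P i.+1) (P j.+1))%:R + to_tgt q,
      to_src q = t - j%:R & (P i == P j.+1) = false].
    have [j_n|nj] := ltnP j n.
      rewrite (step _ j_n) in pqE eq.
      rewrite !dPR ?(leqW ij') // ?(ltnW (leqW ij')) // -!natr1.
      by split; [lra|lra|lra|apply: dij => //; exact: leqW].
    rewrite jS // dist0 mulr0 in pqE; rewrite jS // dist0 in eq.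
    have nt : n%:R <= j%:R :> R by rewrite ler_nat.
    rewrite jS // !dPR // ?(ltnW ij') // -natr1.
    by split; [lra|lra|lra|exact: dij].
  rewrite /cayley_dist /dist_via !vertex_distE sp tp sq tq (dij j) //= nij /=.
  rewrite (dPR i j) ?(ltnW ij') // (dPR i.+1 j) // -natr1.
  apply/eqP; rewrite eq_le !le_min !ge_min; apply/andP; split.
    by apply/orP; right; apply/orP; left; lra.
  by apply/andP; split; apply/andP; split; lra.
subst j; rewrite /cayley_dist sp tp sq tq !eqxx /= ppE pqE.
have [i_n|n_i] := ltnP i n.
  by rewrite step // !mulr1 distrC ger0_norm; lra.
have -> : t = s.
  have : n%:R <= i%:R :> R by rewrite ler_nat.
  by lra.
by rewrite !subrr normr0.
Qed.

End CayleyMetric.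

(** * Transfer of the hypotheses from the Cayley graph to the group *)

Section CayleyHyperbolic.
Local Open Scope classical_set_scope.
Local Open Scope ring_scope.
Variables (R : realType) (G : groupType) (X : set G).
Hypothesis X_inv : inv_closed X.
Hypothesis X_gen : generates X.
Local Notation dist := (ldist (word_length X)).
Local Notation vertex := (cayley_vertex R X).

Lemma cayley_dist_src0 (p : cayley_point R X) u : src p = u -> to_src p = 0 ->
  cayley_dist R X p (vertex u) = 0.
Proof.
move=> pu p0; have [_ tp _] := edge_bounds X_gen p.
have el0 : edge_length (vertex u) = 0 by rewrite /edge_length /= eqxx.
have v0 : to_src (vertex u) = 0 by rewrite /to_src el0 mulr0.
have v1 : to_tgt (vertex u) = 0 by rewrite /to_tgt el0 mulr0.
have d0 : vertex_dist R X u u = 0 by rewrite vertex_distE /ldist mulVg word_length1.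
rewrite /cayley_dist p0 v0 v1 subr0 normr0 /dist_via p0 v0 v1 pu /= d0 !addr0.
case: ifP => // _; case: ifP => // _.
have d_ge0 : 0 <= vertex_dist R X (tgt p) u by exact: ler0n.
by apply/eqP; rewrite eq_le !le_min !ge_min lexx /=; lra.
Qed.

(** The last two clauses allow passing between points of the segment and vertices of the path by
    taking sources. *)
Lemma geodesic_path_segment u v P : geodesic_path X u v P ->
  exists S, [/\ geodesic_segment (cayley_dist R X) (vertex u) (vertex v) S,
    forall q, S q -> exists2 i, (i <= dist u v)%N & src q = P i
  & forall i, (i <= dist u v)%N -> exists2 q, S q & src q = P i].
Proof.
move=> uvP; have [P0 Pn _ _] := uvP.
have /choice[gamma gammaP] s : exists p : cayley_point R X, 0 <= s -> on_path P s p.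
  have [s0|_] := boolP (0 <= s); last by exists (vertex u).
  by have [p sp] := on_path_exists uvP s0; exists p.
have duv : cayley_dist R X (vertex u) (vertex v) = (dist u v)%:R.
  exact: cayley_dist_vertex.
have gamma_dist s t : 0 <= s <= t -> t <= (dist u v)%:R ->
    cayley_dist R X (gamma s) (gamma t) = t - s.
  move=> st tn; apply: (on_path_dist X_gen uvP st tn); apply: gammaP; lra.
exists (gamma @` [set s | 0 <= s <= (dist u v)%:R]); split.
- exists gamma; rewrite duv; split=> //.
  + have [] := gammaP 0 (lexx _); rewrite truncn0 P0 subr0 => g1 _ g2.
    by apply: cayley_dist_src0; rewrite // /to_src g2 mul0r.
  + have [] := gammaP (dist u v)%:R (ler0n _ _).
    rewrite natrK !Pn // => g1 g2 _; apply: cayley_dist_src0 => //.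
    by rewrite /to_src /edge_length g1 g2 eqxx mulr0.
  + move=> s t /andP[s0 sn] /andP[t0 tn]; have [st|/ltW ts] := leP s t.
      by rewrite gamma_dist ?s0 // distrC ger0_norm // subr_ge0.
    by rewrite cayley_distC // gamma_dist ?t0 // ger0_norm // subr_ge0.
- move=> _ [s /andP[s0 sn] <-]; have [-> _ _] := gammaP s s0.
  exists (Num.truncn s) => //; rewrite -(ler_nat R).
  by have /andP[ts _] := truncn_itv s0; lra.
- move=> i i_n; exists (gamma i%:R).
    by exists i%:R => //=; rewrite ler0n ler_nat.
  by have [-> _ _] := gammaP i%:R (ler0n _ _); rewrite natrK.
Qed.

Lemma cayley_four_point : hyperbolic (cayley_dist R X) -> exists D, forall x y z w,
  (dist x z + dist y w <= maxn (dist x y + dist z w) (dist y z + dist x w) + D)%N.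
Proof.
(* Replacing two points by their sources costs 2. *)
move=> [delta delta0 slim]; pose k := (Num.truncn delta + 2)%N.
exists (6 * k + 2)%N; apply: slim_four_point => //.
move=> x y; have [P xyP] := geodesic_path_exists X_gen x y; exists P => // z i i_n.
have [A [xyA _ PA]] := geodesic_path_segment xyP.
have [P1 yzP] := geodesic_path_exists X_gen y z.
have [B [yzB BP _]] := geodesic_path_segment yzP.
have [P2 zxP] := geodesic_path_exists X_gen z x.
have [C [zxC CP _]] := geodesic_path_segment zxP.
have [p Ap pP] := PA i i_n.
have on_geodesic a b Q j : geodesic_path X a b Q -> (j <= dist a b)%N ->
    between X a b (Q j).
  move=> [Q0 Qn _ dQ] jn; have := dQ 0%N j jn; have := dQ j (dist a b).
  by rewrite jn leqnn Q0 (Qn _ (leqnn _)) /between => /(_ isT) -> ->; rewrite subn0 subnKC.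
have [q BCq pq] := slim _ _ _ _ _ _ xyA yzB zxC p Ap.
exists (src q).
  have /andP[+ _] := cayley_dist_src X_inv X_gen p q; rewrite pP => dpq.
  have /andP[_] := truncn_itv delta0; rewrite -natr1 => dl.
  rewrite /k -ltnS -(ltr_nat R) -natr1 natrD; lra.
case: BCq => [/BP|/CP] [j jn ->]; [left|right]; exact: on_geodesic.
Qed.

Lemma cayley_acylindrical : acylindrical (cayley_dist R X) (cayley_act R X) ->
  forall e, exists r N, forall x y, (r <= dist x y)%N -> forall F : nat -> G,
    (forall i, (i <= N)%N ->
       (dist x (F i * x)%g <= e)%N /\ (dist y (F i * y)%g <= e)%N) ->
    exists i j, [/\ (i < j)%N, (j <= N)%N & F i = F j].
Proof.
(* The successor provides the positive displacement bound that acylindricity asks for. *)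
move=> acyl e; have [|r [N [r0 N0 rN]]] := acyl e.+1%:R; first by rewrite ltr0n.
exists (Num.truncn r).+1, N => x y rxy F FN.
have rle : r <= cayley_dist R X (vertex x) (vertex y).
  rewrite cayley_dist_vertex //.
  have /andP[_ r1] := truncn_itv (ltW r0).
  by apply: le_trans (ltW r1) _; rewrite ler_nat.
have := rN _ _ rle; set A := [set g | _] => cardA.
apply: contrapT => noij.
have Finj : {in `I_N.+1 &, injective F}.
  move=> i j; rewrite !inE /= => iN jN Fij; apply: contrapT => ij.
  apply: noij; have [ltij|ltji|//] := ltngtP i j; [exists i, j|exists j, i] => //.
have FA : F @` `I_N.+1 `<=` A.
  move=> _ [i iN <-]; have [Fx Fy] := FN i iN.
  rewrite /A /= !cayley_dist_vertices //=.
  by rewrite !ler_nat; split; apply: leqW.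
have : (`I_N.+1 #<= `I_N)%card.
  apply: card_le_trans cardA; apply: card_le_trans (subset_card_le FA).
  by have := inj_card_eq Finj; rewrite card_eq_sym card_eq_le => /andP[].
by rewrite card_le_II ltnn.
Qed.

Lemma loxodromic_linear_orbit g : loxodromic R X g -> linear_orbit (word_length X) g.
Proof.
move=> [p [lam [kap [lam1 kap0 qi]]]].
pose s := word_length X (src p).
(* The first 2 pays for taking sources and [2 * s] for moving the base point to 1; the final 1
   absorbs the length of [g ^+ k]. *)
pose A := Num.truncn (lam * (kap + 2 + 2 * s%:R + 1)).
exists A.+1 => k; have /andP[+ _] := qi 0 (Posz k).
have := cayley_dist_src X_inv X_gen (cayley_act R X (expgz g 0) p)
  (cayley_act R X (expgz g k) p) => /andP[_ /= d1] kd.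
rewrite expg0 mul1g in d1.
have d3 : (dist (src p) (g ^+ k * src p)%g <= 2 * s + word_length X (g ^+ k)%g)%N.
  have := word_lengthM X_gen (src p)^-1%g (g ^+ k * src p)%g.
  have := word_lengthM X_gen (g ^+ k)%g (src p); rewrite word_lengthV // /s.
  by move=> h1 h2; apply: leq_trans h2 _; rewrite mul2n -addnn -addnA leq_add2l addnC.
rewrite -(ler_nat R) natrD natrM in d3.
have kE : int_dist R 0 (Posz k) = k%:R by rewrite /int_dist sub0r normrN.
rewrite {}kE in kd; set w := word_length X _ in d3 *.
have lam0 : 0 < lam := lt_le_trans ltr01 lam1.
have {kd}k_le : k%:R <= lam * (kap + 2 + 2 * s%:R + w%:R).
  by rewrite mulrC -ler_pdivrMr //; lra.
have s0 : 0 <= s%:R :> R by []; have w0 : 0 <= w%:R :> R by [].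
have ZA : lam * (kap + 2 + 2 * s%:R + 1) <= A.+1%:R.
  have Z0 : 0 <= lam * (kap + 2 + 2 * s%:R + 1) by rewrite mulr_ge0 //; lra.
  by have /andP[_ /ltW] := truncn_itv Z0.
rewrite -(ler_nat R) natrM; apply: le_trans k_le _.
apply: le_trans (ler_wpM2r (ler0n R _) ZA); rewrite -mulrA ler_wpM2l ?(ltW lam0) //.
rewrite -natr1; nra.
Qed.

End CayleyHyperbolic.

(** * The lower bound for the length of the product *)

Theorem lemma2p10 (R : realType) (G : groupType) (X : set G)
    (X_inv : inv_closed X) (X_gen : generates X)
    (X_hyp : hyperbolic (cayley_dist R X))
    (X_acyl : acylindrical (cayley_dist R X) (cayley_act R X)) :
  exists N0 : R, (0 < N0)%R /\
    forall c d : G, loxodromic R X c -> loxodromic R X d -> E_ c <> E_ d ->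
    forall n m : nat, (0 < n)%N -> (0 < m)%N ->
      ((minn n m)%:R / N0 < (word_length X (c ^+ n * d ^+ m)%g)%:R)%R.
Proof.
have [D four_point] := cayley_four_point X_inv X_gen X_hyp.
have ln1 := word_length1 X_gen; have lnV := word_lengthV X_inv X_gen.
have lnM := word_lengthM X_gen.
have [N0 N00 bound] := fellow_travel_E ln1 lnV lnM (word_geodesic X_gen) four_point
  (cayley_acylindrical X_gen X_acyl).
(* The factor 2 turns the successor of a positive length into its double. *)
exists (2 * N0)%:R%R; split; first by rewrite ltr0n muln_gt0.
move=> c d /(loxodromic_linear_orbit X_inv X_gen) clox.
move=> /(loxodromic_linear_orbit X_inv X_gen) dlox neq n m n0 m0.
rewrite ltr_pdivrMr ?ltr0n ?muln_gt0 // -natrM ltr_nat ltnNge; apply/negP => le_min.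
apply: neq.
(* The length of [c ^+ n * d ^+ m] is the distance from [c ^- n] to [d ^+ m], so the bound is
   applied to the inverse of [c]. *)
have cVlox : linear_orbit (word_length X) c^-1%g.
  by have [A cA] := clox; exists A => k; rewrite expVgn lnV.
have EcV : E_ c^-1%g = E_ c.
  by apply: (@E_eq _ _ ln1 _ _ 1 1 clox) => //; right; rewrite !expg1 invgK.
(* Length zero is settled directly: then [d ^+ m] equals [c ^- n], and the two elements are
   commensurable. *)
have [L0|L0] := posnP (word_length X (c ^+ n * d ^+ m)%g).
  apply: (@E_eq _ _ ln1 _ _ n m dlox) => //; right.
  by have /mulg1_eq := word_length_eq0 X_gen L0.
rewrite -EcV; apply: (bound _ _ n m) => //.
rewrite /ldist expVgn invgK; apply: leq_trans le_min.
by rewrite [leqRHS]mulnA [leqRHS]mulnC leq_mul2l muln2 -addnn -addn1 leq_add2l L0 orbT.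
Qed.
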